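(* For all $x,y\in\mathbb{B}^n$ we have $$\frac12\,\rho_{\mathbb{B}^n}(x,y)\le u_{\mathbb{B}^n}(x,y)\le 4\,\rho_{\mathbb{B}^n}(x,y).$$
   Context: Here $n\ge 2$ and $\mathbb{B}^n=\{z\in\mathbb{R}^n:|z|<1\}$ is the Euclidean unit ball. The hyperbolic metric of $\mathbb{B}^n$ is $\rho_{\mathbb{B}^n}(x,y)=\inf_\gamma\int_\gamma \frac{2|dz|}{1-|z|^2}$, the infimum over all rectifiable curves $\gamma\subset\mathbb{B}^n$ joining $x$ and $y$; equivalently $\sinh\left(\frac{\rho_{\mathbb{B}^n}(x,y)}{2}\right)=\frac{|x-y|}{\sqrt{(1-|x|^2)(1-|y|^2)}}$. For a domain (open connected set) $D\subsetneq\mathbb{R}^n$, write $d(x)=\mathrm{dist}(x,\partial D)$ and define $u_D(x,y)=2\log\frac{|x-y|+\max\{d(x),d(y)\}}{\sqrt{d(x)d(y)}}$ for $x,y\in D$; for $D=\mathbb{B}^n$ one has $d(x)=1-|x|$. *)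

(* Defs.v *)
From HB Require Import structures.
From mathcomp Require Import all_boot all_order all_algebra.
From mathcomp Require Import all_classical all_reals all_analysis.
Set Implicit Arguments.
Unset Strict Implicit.
Unset Printing Implicit Defensive.
Import Order.TTheory GRing.Theory Num.Theory.
Import numFieldNormedType.Exports.
Local Open Scope classical_set_scope.
Local Open Scope ring_scope.

(* The library norm on row vectors is the sup norm; the Euclidean norm induces
   the same topology, so the library's [closure], [interior] and [continuous]
   can be used together with it. *)
Definition enorm (R : realType) (n : nat) (v : 'rV[R]_n) : R :=
  Num.sqrt (\sum_(i < n) v ord0 i ^+ 2).

Definition unit_ball (R : realType) (n : nat) : set 'rV[R]_n :=
  [set z | enorm z < 1].

(* As in [itv_partition], a subdivision a = t_0 < t_1 < ... < t_N = b is given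
   by the sequence s = [:: t_1; ...; t_N]; then t_i is [nth b (a :: s) i]. *)
Definition polygonal_length (R : realType) (n : nat) (a b : R)
    (g : R -> 'rV[R]_n) (s : seq R) : R :=
  let t := nth b (a :: s) in
  \sum_(0 <= i < size s) enorm (g (t i.+1) - g (t i)).

Definition rectifiable_curve (R : realType) (n : nat) (a b : R)
    (g : R -> 'rV[R]_n) : Prop :=
  {within `[a, b], continuous g} /\
  has_ubound [set polygonal_length a b g s | s in itv_partition a b].

(* [is_line_integral w a b g I] means I = \int_g w |dz|, the limit of the sums
   \sum_i w (g (tau_i)) |g (t_(i+1)) - g (t_i)| with t_i <= tau_i <= t_(i+1),
   as the mesh of the subdivision goes to 0.  The limit exists whenever g is
   rectifiable and w is continuous along g. *)
Definition is_line_integral (R : realType) (n : nat) (w : 'rV[R]_n -> R)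
    (a b : R) (g : R -> 'rV[R]_n) (I : R) : Prop :=
  forall eps : R, 0 < eps -> exists2 delta : R, 0 < delta &
  forall (s : seq R) (tau : nat -> R),
    let t := nth b (a :: s) in
    itv_partition a b s ->
    (forall i, (i < size s)%N -> t i.+1 - t i < delta) ->
    (forall i, (i < size s)%N -> t i <= tau i <= t i.+1) ->
    `|\sum_(0 <= i < size s) w (g (tau i)) * enorm (g (t i.+1) - g (t i)) - I|
      < eps.

Definition hyperbolic_density (R : realType) (n : nat) (z : 'rV[R]_n) : R :=
  2 / (1 - enorm z ^+ 2).

Definition hyperbolic_metric (R : realType) (n : nat) (x y : 'rV[R]_n) : R :=
  inf [set I | exists (a b : R) (g : R -> 'rV[R]_n),
    [/\ a <= b, rectifiable_curve a b g,
        (forall t, t \in `[a, b] -> unit_ball (g t)),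
        g a = x /\ g b = y
      & is_line_integral (@hyperbolic_density R n) a b g I]].

Definition boundary (R : realType) (n : nat) (D : set 'rV[R]_n) :
    set 'rV[R]_n :=
  closure D `\` interior D.

Definition boundary_dist (R : realType) (n : nat) (D : set 'rV[R]_n)
    (x : 'rV[R]_n) : R :=
  inf [set enorm (x - z) | z in boundary D].

Definition u_metric (R : realType) (n : nat) (D : set 'rV[R]_n)
    (x y : 'rV[R]_n) : R :=
  let d := boundary_dist D in
  2 * ln ((enorm (x - y) + Num.max (d x) (d y)) / Num.sqrt (d x * d y)).

(* Main.v *)
(** Upper bound of [u]: the density is at least [1 / d(z)], so for every function
    [f >= d] that is 1-Lipschitz, [ln f] varies by at most the hyperbolic length
    along any curve.  With [f = d], [d(x) + |z - x|] and [d(y) + |z - y|] this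
    gives [u <= 3 rho].

    Lower bound of [u]: the geodesic from [x] to [y], obtained from the
    hyperboloid model, has length [L] with [sinh (L / 2) = g], where
    [g = |x - y| / sqrt ((1 - |x|^2) (1 - |y|^2))].  Then
    [exp (L / 2) = g + sqrt (1 + g^2) <= 1 + 2 g <= (|x - y| + m)^2 / (d(x) d(y))]
    with [m = max (d(x), d(y))], which says [L <= 2 u]. *)
Require Import Defs.
From mathcomp Require Import all_boot all_order all_algebra.
From mathcomp Require Import all_classical all_reals all_analysis.
From mathcomp Require Import ring lra.
Import Order.TTheory GRing.Theory Num.Theory.
Import numFieldNormedType.Exports.
Local Open Scope classical_set_scope.
Local Open Scope ring_scope.

(** * Euclidean norm on row vectors and the boundary of the unit ball *)

Section Euclidean.
Context {R : realType} {n : nat}.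
Implicit Types (a b : R) (u v w : 'rV[R]_n).

Definition edot u v : R := \sum_(i < n) u ord0 i * v ord0 i.

Lemma edotC u v : edot u v = edot v u.
Proof. by apply: eq_bigr => i _; rewrite mulrC. Qed.

Lemma edotDl u v w : edot (u + v) w = edot u w + edot v w.
Proof. by rewrite -big_split; apply: eq_bigr => i _; rewrite mxE mulrDl. Qed.

Lemma edotZl a u v : edot (a *: u) v = a * edot u v.
Proof. by rewrite mulr_sumr; apply: eq_bigr => i _; rewrite mxE mulrA. Qed.

Lemma edotNl u v : edot (- u) v = - edot u v.
Proof. by rewrite -scaleN1r edotZl mulN1r. Qed.

Lemma edotDr u v w : edot w (u + v) = edot w u + edot w v.
Proof. by rewrite edotC edotDl !(edotC _ w). Qed.

Lemma edotZr a u v : edot u (a *: v) = a * edot u v.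
Proof. by rewrite edotC edotZl edotC. Qed.

Lemma edotNr u v : edot u (- v) = - edot u v.
Proof. by rewrite edotC edotNl edotC. Qed.

Definition edotE := (edotDl, edotDr, edotZl, edotZr, edotNl, edotNr).

Lemma edot_ge0 u : 0 <= edot u u.
Proof. by apply: sumr_ge0 => i _; rewrite -expr2 sqr_ge0. Qed.

Lemma edotvv_eq0 v : edot v v = 0 -> v = 0.
Proof.
move/eqP; rewrite psumr_eq0 => [|i _]; last by rewrite -expr2 sqr_ge0.
move=> /allP v0; apply/rowP => i; rewrite [RHS]mxE.
by move: (v0 i (mem_index_enum i)); rewrite -expr2 sqrf_eq0 => /eqP.
Qed.

(** Cauchy-Schwarz: [edot v v *: u - edot u v *: v] has squared norm [edot v v] times the difference
    of the two sides. *)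
Lemma edot_sqr_le u v : edot u v ^+ 2 <= edot u u * edot v v.
Proof.
have [v0|v0] := eqVneq (edot v v) 0; first by rewrite v0 (edotvv_eq0 _ v0)
  -(scale0r 0) edotZr mul0r expr0n mulr0.
have vgt : 0 < edot v v by rewrite lt_def v0 edot_ge0.
have := edot_ge0 (edot v v *: u - edot u v *: v).
rewrite !edotE (edotC v u) => H.
rewrite -subr_ge0 -(pmulr_rge0 _ vgt).
by apply: le_trans H _; rewrite le_eqVlt; apply/orP; left; apply/eqP; ring.
Qed.

Lemma enormE u : enorm u = Num.sqrt (edot u u).
Proof. by congr Num.sqrt; apply: eq_bigr => i _; rewrite expr2. Qed.

Lemma sqr_enorm u : enorm u ^+ 2 = edot u u.
Proof. by rewrite enormE sqr_sqrtr// edot_ge0. Qed.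

Lemma enorm_ge0 u : 0 <= enorm u.
Proof. exact: sqrtr_ge0. Qed.

Lemma enormZ a u : enorm (a *: u) = `|a| * enorm u.
Proof.
by rewrite !enormE !edotE mulrA -expr2 sqrtrM ?sqr_ge0// sqrtr_sqr.
Qed.

Lemma enorm_eq0 u : enorm u = 0 -> u = 0.
Proof. by move=> u0; apply: edotvv_eq0; rewrite -sqr_enorm u0 expr0n. Qed.

Lemma enormN u : enorm (- u) = enorm u.
Proof. by rewrite -scaleN1r enormZ normrN1 mul1r. Qed.

Lemma enormBC u v : enorm (u - v) = enorm (v - u).
Proof. by rewrite -enormN opprB. Qed.

Lemma enorm0 : enorm (0 : 'rV[R]_n) = 0.
Proof. by rewrite -(scale0r 0) enormZ normr0 mul0r. Qed.

Lemma edot_le u v : edot u v <= enorm u * enorm v.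
Proof.
have uv0 : 0 <= enorm u * enorm v by rewrite mulr_ge0 ?enorm_ge0.
rewrite (le_trans (ler_norm _))// -ler_sqr ?nnegrE// real_normK ?num_real//.
by rewrite exprMn !sqr_enorm edot_sqr_le.
Qed.

Lemma enormD_le u v : enorm (u + v) <= enorm u + enorm v.
Proof.
have u0 := enorm_ge0 u; have v0 := enorm_ge0 v.
rewrite -ler_sqr ?nnegrE ?addr_ge0 ?enorm_ge0// sqr_enorm !edotE (edotC v u).
rewrite sqrrD !sqr_enorm; have := edot_le u v; lra.
Qed.

Lemma enorm_dist_le w u v : enorm (u - v) <= enorm (u - w) + enorm (w - v).
Proof. by have := enormD_le (u - w) (w - v); rewrite subrKA. Qed.

Lemma enormB_ge u v : enorm u - enorm v <= enorm (u - v).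
Proof. by rewrite lerBlDr; have := enormD_le (u - v) v; rewrite subrK. Qed.

Lemma continuous_enorm : continuous (@enorm R n).
Proof.
move=> u; apply: continuous_comp; last exact: sqrt_continuous.
apply: continuous_big u => [|i _ u]; first exact: add_continuous.
apply: (@continuous_comp _ _ _ (fun v : 'rV[R]_n => v ord0 i) (fun a => a ^+ 2)).
  exact: coord_continuous.
exact: exprn_continuous.
Qed.

Lemma boundary_unit_ball_ge1 u : boundary (@unit_ball R n) u -> 1 <= enorm u.
Proof.
case=> _ uNint; rewrite leNgt; apply/negP => u1; apply: uNint.
exact: (continuous_enorm u _ (lt_nbhsl u1)).
Qed.

(** As [t] tends to 1, the points [t *: u] with [t < 1] put [u] in the closure, and those with
    [t > 1] keep it out of the interior. *)
Lemma sphere_boundary_unit_ball u : enorm u = 1 -> boundary (@unit_ball R n) u.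
Proof.
move=> u1; have cu : (fun t : R => t *: u) @ (1 : R) --> u.
  rewrite -[X in _ --> X](scale1r u).
  by apply: cvgZ; [exact: cvg_id | exact: cvg_cst].
split=> [B /cu Bu|].
  have [t t1 [t0 Bt]] : exists2 t : R, t < 1 & 0 < t /\ B (t *: u).
    have : \forall t \near (1 : R)^'-, t < 1 /\ (0 < t /\ B (t *: u)).
      near=> t; do 2?split; near: t; [exact: nbhs_left_lt | | ].
      - exact: nbhs_left_gt.
      - exact: cvg_at_left_filter Bu.
    by move=> /filter_ex[t [? ?]]; exists t.
  exists (t *: u); split => //.
  by rewrite /unit_ball/= enormZ u1 mulr1 gtr0_norm.
move=> /cu Bu.
have : \forall t \near (1 : R)^'+, 1 < t /\ unit_ball (t *: u).
  near=> t; split; near: t; [exact: nbhs_right_gt |].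
  exact: cvg_at_right_filter Bu.
move=> /filter_ex[t [t1]]; rewrite /unit_ball/= enormZ u1 mulr1.
by rewrite gtr0_norm ?(lt_trans _ t1)// ltNge ltW.
Unshelve. all: by end_near. Qed.

Lemma boundary_dist_unit_ball u : (0 < n)%N -> unit_ball u ->
  boundary_dist (@unit_ball R n) u = 1 - enorm u.
Proof.
move=> n0 u1; set S := [set enorm (u - z) | z in boundary (@unit_ball R n)].
have lbS : lbound S (1 - enorm u).
  move=> _ [z /boundary_unit_ball_ge1 z1 <-].
  by rewrite enormBC (le_trans _ (enormB_ge z u))// lerB.
have [z zS] : exists2 z, boundary (@unit_ball R n) z & enorm (u - z) = 1 - enorm u.
  have [u0|u0] := eqVneq (enorm u) 0.
    (* All points of the sphere are equally far from the centre, so any unit vector serves; [n0]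
       supplies a coordinate. *)
    pose e : 'rV[R]_n := delta_mx ord0 (Ordinal n0).
    have e1 : enorm e = 1.
      rewrite /enorm (bigD1 (Ordinal n0))//= big1 => [|i ni].
        by rewrite addr0 !mxE !eqxx expr1n sqrtr1.
      by rewrite !mxE (negbTE ni) andbF expr0n.
    exists e; first exact: sphere_boundary_unit_ball.
    apply/eqP; rewrite eq_le; apply/andP; split.
      by rewrite (le_trans (enormD_le _ _))// enormN e1 u0 add0r subr0.
    by rewrite enormBC -e1 enormB_ge.
  exists ((enorm u)^-1 *: u).
    apply: sphere_boundary_unit_ball.
    by rewrite enormZ ger0_norm ?invr_ge0 ?enorm_ge0// mulVf.
  rewrite -[X in enorm (X - _)]scale1r -scalerBl enormZ ltr0_norm.
    by rewrite opprB mulrBl mulVf// mul1r.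
  by rewrite subr_lt0 invf_gt1// lt_def u0 enorm_ge0.
move=> zu; apply/eqP; rewrite eq_le; apply/andP; split.
  rewrite -zu; apply: ge_inf; last by exists z.
  by exists (1 - enorm u).
by apply: lb_le_inf => //; exists (enorm (u - z)), z.
Qed.

End Euclidean.

(** * Riemann sums for line integrals *)

Section LineIntegral.
Context {R : realType} {n : nat}.
Implicit Types (a b delta I : R) (g : R -> 'rV[R]_n) (w phi : 'rV[R]_n -> R).

(** Induction on a bound [N] for the number of steps of length [delta / 2]. *)
Lemma fine_itv_partition a b delta : a <= b -> 0 < delta ->
  exists2 s, itv_partition a b s & forall i, (i < size s)%N ->
    nth b (a :: s) i.+1 - nth b (a :: s) i < delta.
Proof.
move=> ab d0.
have [N] : exists N : nat, b - a <= delta / 2 * N%:R.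
  exists (Num.trunc ((b - a) / (delta / 2))).+1.
  by rewrite mulrC -ler_pdivrMr ?divr_gt0// ltW// truncnS_gt.
elim: N a ab => [|N IH] a ab; first rewrite mulr0 => ba.
  have -> : a = b by lra.
  by exists [::] => //; split => /=.
move=> abN; have [ad|ad] := leP b (a + delta / 2).
  have [<-|aneb] := eqVneq a b; first by exists [::] => //; split => /=.
  exists [:: b]; first by apply: itv_partition1; rewrite lt_neqAle aneb.
  by case=> //= _; lra.
have [||s [ps ls] ms] := IH (a + delta / 2); [lra | |].
  by move: abN; rewrite -natr1; lra.
exists (a + delta / 2 :: s).
  by split => //=; rewrite ps andbT; lra.
case=> [_ /=|i /=]; first lra.
exact: ms.
Qed.

Lemma itv_partition_le_nthS a b s i : itv_partition a b s -> (i < size s)%N ->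
  nth b (a :: s) i <= nth b (a :: s) i.+1.
Proof. by case=> + _ => /pathP sP /sP => /(_ b)/ltW. Qed.

(** Tagging each subinterval with the endpoint where [w] is larger makes the Riemann sum dominate
    the telescoping sum of the increments of [phi]. *)
Lemma line_integral_ge w phi a b g I : a <= b ->
  (forall r t, r \in `[a, b] -> t \in `[a, b] ->
    phi (g t) - phi (g r) <= Num.max (w (g r)) (w (g t)) * enorm (g t - g r)) ->
  is_line_integral w a b g I -> phi (g b) - phi (g a) <= I.
Proof.
move=> ab phiP gI; apply/ler_addgt0Pr => e /gI[delta d0 H].
have [s ps ms] := fine_itv_partition a b delta ab d0.
pose t := nth b (a :: s).
pose tau i := if w (g (t i)) <= w (g (t i.+1)) then t i.+1 else t i.
have {}H : `|\sum_(0 <= i < size s) w (g (tau i)) * enorm (g (t i.+1) - g (t i)) - I| < e.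
  apply: H => // i si; have := itv_partition_le_nthS _ _ _ _ ps si.
  by rewrite /tau; case: ifP => _ h; rewrite lexx ?andbT.
suff : phi (g b) - phi (g a) <=
    \sum_(0 <= i < size s) w (g (tau i)) * enorm (g (t i.+1) - g (t i)).
  by move: H; rewrite ltr_norml => /andP[_ H1] H2; lra.
have -> : phi (g b) - phi (g a) = \sum_(0 <= i < size s) (phi (g (t i.+1)) - phi (g (t i))).
  by rewrite (telescope_sumr (fun i => phi (g (t i))))// {1}/t (itv_partition_nth_size _ ps).
rewrite big_nat_cond [leRHS]big_nat_cond; apply: ler_sum => i; rewrite andbT => /= si.
have tab j : (j <= size s)%N -> t j \in `[a, b].
  by move=> js; rewrite in_itv/= itv_partition_nth_ge ?itv_partition_nth_le.
apply: le_trans (phiP _ _ (tab _ (ltnW si)) (tab _ si)) _.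
apply: ler_wpM2r; first exact: enorm_ge0.
by rewrite /tau; case: ifP => h; rewrite ge_max lexx ?h ?andbT// ltW// ltNge h.
Qed.

(** The hypothesis says that [g] is parametrized by [w]-length up to a small relative error; the
    errors add up to at most [eps * (b - a)]. *)
Lemma is_line_integral_arclength w a b g : a <= b ->
  (forall eps, 0 < eps -> exists2 delta, 0 < delta & forall r t tau,
     a <= r -> t <= b -> t - r < delta -> r <= tau <= t ->
     `|w (g tau) * enorm (g t - g r) - (t - r)| <= eps * (t - r)) ->
  is_line_integral w a b g (b - a).
Proof.
move=> ab H eps e0.
(* The added 1 keeps the divisor positive when [a = b] and makes the final inequality strict. *)
have e1 : 0 < eps / (b - a + 1) by rewrite divr_gt0//; lra.
have [delta d0 {}H] := H _ e1; exists delta => // s tau t ps ms taus.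
have -> : b - a = \sum_(0 <= i < size s) (t i.+1 - t i).
  by rewrite telescope_sumr// {1}/t (itv_partition_nth_size _ ps).
rewrite -sumrB; apply: le_lt_trans (ler_norm_sum _ _ _) _.
apply: (@le_lt_trans _ _ (\sum_(0 <= i < size s) eps / (b - a + 1) * (t i.+1 - t i))).
  rewrite big_nat_cond [leRHS]big_nat_cond; apply: ler_sum => i; rewrite andbT => /= si.
  by apply: H; [apply: itv_partition_nth_ge => //; exact: ltnW
    | exact: itv_partition_nth_le | exact: ms | exact: taus].
rewrite -mulr_sumr telescope_sumr// {1}/t (itv_partition_nth_size _ ps)//=.
have ba : 0 < b - a + 1 by lra.
by rewrite mulrAC ltr_pdivrMr// ltr_pM2l// ltrDl.
Qed.

Lemma lipschitz_rectifiable a b g C :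
  {within `[a, b], continuous g} ->
  (forall r t, a <= r -> r <= t -> t <= b -> enorm (g t - g r) <= C * (t - r)) ->
  rectifiable_curve a b g.
Proof.
move=> gcont gC; split => //; exists (C * (b - a)) => _ [s ps <-].
rewrite /polygonal_length; set t := nth b (a :: s).
have -> : b - a = \sum_(0 <= i < size s) (t i.+1 - t i).
  by rewrite telescope_sumr// {1}/t (itv_partition_nth_size _ ps).
rewrite mulr_sumr big_nat_cond [leRHS]big_nat_cond.
apply: ler_sum => i; rewrite andbT => /= si; apply: gC.
- by apply: itv_partition_nth_ge => //; exact: ltnW.
- exact: itv_partition_le_nthS.
- exact: itv_partition_nth_le.
Qed.

End LineIntegral.

Lemma lnB_le {R : realType} (s t : R) : 0 < s -> 0 < t -> ln s - ln t <= (s - t) / t.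
Proof.
move=> s0 t0; rewrite -ln_div ?posrE//.
have -> : s / t = 1 + (s - t) / t by rewrite mulrBl divff ?gt_eqF// addrC subrK.
by apply: le_ln1Dx; rewrite ltr_pdivlMr//; lra.
Qed.

(** * Lower bounds for hyperbolic length, and the upper bound of u *)

Section HyperbolicLength.
Context {R : realType} {n : nat}.
Implicit Types (I : R) (x y z p q : 'rV[R]_n).

(** Membership in the set whose infimum is [hyperbolic_metric x y]. *)
Definition hyperbolic_length x y I : Prop :=
  exists (a b : R) (g : R -> 'rV[R]_n),
    [/\ a <= b, rectifiable_curve a b g,
        (forall t, t \in `[a, b] -> unit_ball (g t)),
        g a = x /\ g b = y
      & is_line_integral (@hyperbolic_density R n) a b g I].

Lemma hyperbolic_density_ge z : unit_ball z ->
  (1 - enorm z)^-1 <= hyperbolic_density z.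
Proof.
rewrite /unit_ball/= => z1; have z0 := enorm_ge0 z.
have d0 : 0 < 1 - enorm z by lra.
rewrite /hyperbolic_density.
have -> : 1 - enorm z ^+ 2 = (1 - enorm z) * (1 + enorm z) by ring.
rewrite invfM mulrCA -[leLHS]mulr1 ler_pM2l ?invr_gt0//.
by rewrite ler_pdivlMr; lra.
Qed.

(** [ln (f q) - ln (f p)] is at most [(f q - f p) / f p], hence at most
    [enorm (q - p) / (1 - enorm p)], which the density dominates. *)
Lemma hyperbolic_length_ge_ln (f : 'rV[R]_n -> R) x y I :
  (forall p q, f q - f p <= enorm (q - p)) ->
  (forall z, unit_ball z -> 1 - enorm z <= f z) ->
  hyperbolic_length x y I -> `|ln (f y) - ln (f x)| <= I.
Proof.
move=> flip fge [a [b [g [ab _ gball [<- <-] gI]]]].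
have step p q : unit_ball p -> unit_ball q ->
    ln (f q) - ln (f p) <= hyperbolic_density p * enorm (q - p).
  move=> pB qB.
  have fp : 0 < f p by rewrite (lt_le_trans _ (fge _ pB))// subr_gt0.
  have fq : 0 < f q by rewrite (lt_le_trans _ (fge _ qB))// subr_gt0.
  apply: le_trans (lnB_le _ _ fq fp) _.
  apply: (@le_trans _ _ (enorm (q - p) / f p)).
    by rewrite ler_pM2r ?invr_gt0.
  rewrite mulrC ler_wpM2r ?enorm_ge0//.
  apply: le_trans (hyperbolic_density_ge _ pB).
  by rewrite lef_pV2 ?posrE ?subr_gt0// fge.
rewrite ler_norml lerNl opprB; apply/andP; split.
  (* For [- ln f], exchanging the points in [step] puts the density at the other endpoint; the
     maximum in [line_integral_ge] allows this. *)
  have -> : ln (f (g a)) - ln (f (g b)) = (- ln (f (g b))) - (- ln (f (g a))) by ring.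
  apply: (line_integral_ge _ (fun z => - ln (f z)) _ _ _ _ ab _ gI) => r t rab tab.
  rewrite opprK addrC enormBC.
  apply: le_trans (step _ _ (gball _ tab) (gball _ rab)) _.
  by rewrite ler_wpM2r ?enorm_ge0// le_max lexx orbT.
apply: (line_integral_ge _ (fun z => ln (f z)) _ _ _ _ ab _ gI) => r t rab tab.
apply: le_trans (step _ _ (gball _ rab) (gball _ tab)) _.
by rewrite ler_wpM2r ?enorm_ge0// le_max lexx.
Qed.

Lemma u_metric_unit_ball x y : (0 < n)%N -> unit_ball x -> unit_ball y ->
  u_metric (@unit_ball R n) x y =
    2 * ln (enorm (x - y) + Num.max (1 - enorm x) (1 - enorm y))
    - (ln (1 - enorm x) + ln (1 - enorm y)).
Proof.
move=> n0 x1 y1; rewrite /u_metric !boundary_dist_unit_ball//.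
have dx : 0 < 1 - enorm x by rewrite subr_gt0.
have dy : 0 < 1 - enorm y by rewrite subr_gt0.
have dxy := mulr_gt0 dx dy.
rewrite ln_div ?posrE ?sqrtr_gt0//; last first.
  by rewrite ltr_wpDl ?enorm_ge0// lt_max dx.
rewrite -lnM// -[in RHS](sqr_sqrtr (ltW dxy)) lnXn ?sqrtr_gt0//.
by rewrite mulrBr [X in _ - X = _]mulr_natl.
Qed.

(** Let [m] be the larger boundary distance, attained at [z]. Then u is
    [2 (ln (m + |x - y|) - ln m)] plus [|ln d(x) - ln d(y)|]. The first difference is the variation
    of [ln (m + |p - z|)] between the endpoints, so all three terms are at most [I]. *)
Lemma u_metric_le_hyperbolic_length x y I : (0 < n)%N ->
  unit_ball x -> unit_ball y -> hyperbolic_length x y I ->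
  u_metric (@unit_ball R n) x y <= 3 * I.
Proof.
move=> n0 x1 y1 xyI; rewrite u_metric_unit_ball//.
have D z p : `|ln (1 - enorm z + enorm (y - z)) - ln (1 - enorm z + enorm (x - z))| <= I.
  apply: (hyperbolic_length_ge_ln (fun p => 1 - enorm z + enorm (p - z))) => // [p1 q|p1 _].
    by have := enorm_dist_le p1 q z; lra.
  by have := enormB_ge z p1; rewrite enormBC; lra.
have : `|ln (1 - enorm y) - ln (1 - enorm x)| <= I.
  apply: (hyperbolic_length_ge_ln (fun p => 1 - enorm p)) => // p q.
  by have := enormB_ge p q; rewrite enormBC; lra.
rewrite ler_norml => /andP[].
case: (leP (1 - enorm x) (1 - enorm y)) => _.
  have := D y x; rewrite ler_norml => /andP[].
  rewrite subrr enorm0 addr0 (addrC (enorm _)).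
  by lra.
have := D x y; rewrite ler_norml => /andP[].
rewrite subrr enorm0 addr0 (addrC (enorm _)) (enormBC x).
by lra.
Qed.

End HyperbolicLength.

(* [(al, u)] and [(be, v)] are null vectors for the Lorentz form
   [a * b - edot A B], with product 1/2, so [(P t, X t)] runs along the unit
   hyperboloid; projecting from [(-1, 0)] gives a geodesic of the ball,
   parametrized by hyperbolic arc length. *)
Section Geodesic.
Context {R : realType} {n : nat}.
Variables (u v : 'rV[R]_n) (al be : R).
Hypotheses (al_ge0 : 0 <= al) (be_ge0 : 0 <= be).
Hypotheses (null_u : edot u u = al ^+ 2) (null_v : edot v v = be ^+ 2).
Hypothesis lorentz_uv : edot u v = al * be - 2^-1.

Let P t := al * expR t + be * expR (- t).
Let X t : 'rV[R]_n := expR t *: u + expR (- t) *: v.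
Let Y t := 1 + P t.

Definition geodesic (t : R) : 'rV[R]_n := (Y t)^-1 *: X t.

Let P_ge0 t : 0 <= P t.
Proof. by rewrite addr_ge0// mulr_ge0// expR_ge0. Qed.

Let Y_gt0 t : 0 < Y t.
Proof. by have := P_ge0 t; rewrite /Y; lra. Qed.

(** Equivalently, the Lorentz product of the points at times [t] and [r] is [cosh (t - r)]. *)
Let edotX r t : edot (X t) (X r) = P t * P r - (expR (t - r) + expR (r - t)) / 2.
Proof.
rewrite /X !edotE null_u null_v (edotC v u) lorentz_uv /P !expRD.
by field.
Qed.

Let edotXX t : edot (X t) (X t) = P t ^+ 2 - 1.
Proof. by rewrite edotX subrr expR0; field. Qed.

Let sqr_enorm_geodesic t : enorm (geodesic t) ^+ 2 = (P t - 1) / Y t.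
Proof.
rewrite sqr_enorm /geodesic edotZl edotZr edotXX; have := Y_gt0 t; rewrite /Y => Yt.
by field; rewrite gt_eqF.
Qed.

Let density_geodesic t : hyperbolic_density (geodesic t) = Y t.
Proof.
rewrite /hyperbolic_density sqr_enorm_geodesic; have := Y_gt0 t; rewrite /Y => Yt.
have -> : 1 - (P t - 1) / (1 + P t) = 2 / (1 + P t) by field; rewrite gt_eqF.
by field; rewrite gt_eqF.
Qed.

Lemma unit_ball_geodesic t : unit_ball (geodesic t).
Proof.
rewrite /unit_ball/= -ltr_sqr ?nnegrE ?enorm_ge0// sqr_enorm_geodesic expr1n.
by rewrite ltr_pdivrMr// /Y; lra.
Qed.

(* With h = t - r, this is 4 sinh^2(h/2) / (Y r * Y t). *)
Let sqr_enorm_geodesicB r t : enorm (geodesic t - geodesic r) ^+ 2 =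
  (expR (t - r) + expR (r - t) - 2) / (Y r * Y t).
Proof.
rewrite sqr_enorm /geodesic edotDl !edotDr !edotNl !edotNr !edotZl !edotZr !edotXX (edotC (X r)) edotX.
have := Y_gt0 t; have := Y_gt0 r; rewrite /Y => Yt Yr.
by field; rewrite !gt_eqF.
Qed.

(** Each nonnegative summand [1], [al * expR t], [be * expR (- t)] of [Y] grows or shrinks by a
    factor of at most [expR (t - r)]. *)
Let Y_le r t : r <= t -> Y r <= expR (t - r) * Y t /\ Y t <= expR (t - r) * Y r.
Proof.
move=> rt; have h0 : 0 <= t - r by lra.
have E1 : 1 <= expR (t - r) by have := expR_ge1Dx (t - r); lra.
have [k [-> k0]] : exists k, t = r + k /\ 0 <= k by exists (t - r); split => //; ring.
have -> : r + k - r = k by ring.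
have K1 : 1 <= expR k by have := expR_ge1Dx k; lra.
have K2 : expR k * expR (- k) = 1 by rewrite -expRD subrr expR0.
rewrite /Y /P opprD !expRD; move: K1 K2; set K := expR k; set K' := expR (- k) => K1 K2.
have K'0 : 0 < K' := expR_gt0 _.
have Er := expR_gt0 r; have Er' := expR_gt0 (- r).
have a1 : 0 <= al * expR r by rewrite mulr_ge0// ltW.
have b1 : 0 <= be * expR (- r) by rewrite mulr_ge0// ltW.
have -> : K * (1 + (al * (expR r * K) + be * (expR (- r) * K'))) =
  K + (al * expR r) * K ^+ 2 + be * expR (- r) * (K * K') by ring.
have -> : K * (1 + (al * expR r + be * expR (- r))) =
  K + (al * expR r) * K + be * expR (- r) * K by ring.
rewrite K2 !mulrA; split.
  have : 0 <= al * expR r * (K ^+ 2 - 1) by rewrite mulr_ge0// subr_ge0 exprn_ege1.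
  lra.
have : K' <= 1 by rewrite -K2 ler_peMl// ltW.
move=> K'1; have : 0 <= be * expR (- r) * (K - K').
  by rewrite mulr_ge0// subr_ge0 (le_trans K'1).
lra.
Qed.

(** Here and in the next bound, [expR h + expR (- h) - 2] is written as
    [expR (- h) * (expR h - 1) ^+ 2] or [expR h * (1 - expR (- h)) ^+ 2], and [expR] lies above its
    tangent at 0. *)
Let coshB_ge (h : R) : 0 <= h -> h ^+ 2 <= expR h * (expR h + expR (- h) - 2).
Proof.
move=> h0; have E : expR h * expR (- h) = 1 by rewrite -expRD subrr expR0.
have -> : expR h * (expR h + expR (- h) - 2) = (expR h - 1) ^+ 2.
  by rewrite !mulrDr E; ring.
by rewrite ler_sqr ?nnegrE//; have := expR_ge1Dx h; lra.
Qed.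

Let coshB_le (h : R) : 0 <= h -> expR h + expR (- h) - 2 <= expR h * h ^+ 2.
Proof.
move=> h0; have E : expR h * expR (- h) = 1 by rewrite -expRD subrr expR0.
have -> : expR h + expR (- h) - 2 = expR h * (1 - expR (- h)) ^+ 2.
  transitivity (expR h - 2 * (expR h * expR (- h)) + (expR h * expR (- h)) * expR (- h)).
    by rewrite E; ring.
  by ring.
rewrite ler_pM2l ?expR_gt0// ler_sqr ?nnegrE//.
  by have := expR_ge1Dx (- h); lra.
by rewrite subr_ge0 -expR0 ler_expR oppr_le0.
Qed.

(** Put [h = t - r]. In the square of the middle term, [Y tau ^+ 2 / (Y r * Y t)] lies between
    [expR (- h)] and [expR h] by [Y_le], and the cosh factor is [h ^+ 2] up to the same factors; the
    square root leaves one of them. *)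
Let arc_bounds r t tau : r <= tau <= t ->
  (t - r) * expR (- (t - r)) <= Y tau * enorm (geodesic t - geodesic r) <=
  (t - r) * expR (t - r).
Proof.
move=> /andP[rtau taut]; have rt := le_trans rtau taut.
have h0 : 0 <= t - r by lra.
have [Y1 Y2] := Y_le _ _ rtau; have [Y3 Y4] := Y_le _ _ taut.
have Eh : expR (t - r) = expR (tau - r) * expR (t - tau) by rewrite -expRD; congr expR; ring.
have Yr := Y_gt0 r; have Yt := Y_gt0 t; have Ytau := Y_gt0 tau.
have YY : 0 < Y r * Y t by rewrite mulr_gt0.
have up : Y tau ^+ 2 <= expR (t - r) * (Y r * Y t).
  rewrite Eh mulrACA expr2; apply: ler_pM => //; exact: ltW.
have dn : Y r * Y t <= expR (t - r) * Y tau ^+ 2.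
  rewrite Eh expr2 mulrACA; apply: ler_pM => //; exact: ltW.
have E0 := expR_gt0 (t - r).
have C1 := coshB_ge _ h0; have C2 := coshB_le _ h0.
have sqE : (Y tau * enorm (geodesic t - geodesic r)) ^+ 2 =
    Y tau ^+ 2 / (Y r * Y t) * (expR (t - r) + expR (- (t - r)) - 2).
  by rewrite exprMn sqr_enorm_geodesicB opprB mulrA mulrAC.
have C0 : 0 <= expR (t - r) + expR (- (t - r)) - 2.
  by rewrite -(pmulr_rge0 _ E0); apply: le_trans C1; exact: sqr_ge0.
have W0 : 0 <= Y tau * enorm (geodesic t - geodesic r).
  by rewrite mulr_ge0 ?enorm_ge0// ltW.
have he0 s : 0 <= (t - r) * expR s by rewrite mulr_ge0// expR_ge0.
apply/andP; split; rewrite -ler_sqr ?nnegrE// sqE.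
  have Q : expR (- (t - r)) <= Y tau ^+ 2 / (Y r * Y t).
    by rewrite ler_pdivlMr// expRN ler_pdivrMl.
  apply: le_trans (ler_wpM2r C0 Q).
  have -> : ((t - r) * expR (- (t - r))) ^+ 2 =
      expR (- (t - r)) * (expR (- (t - r)) * (t - r) ^+ 2) by ring.
  by rewrite ler_pM2l ?expR_gt0// {1}expRN ler_pdivrMl.
have Q : Y tau ^+ 2 / (Y r * Y t) <= expR (t - r) by rewrite ler_pdivrMr.
apply: le_trans (ler_wpM2r C0 Q) _.
rewrite exprMn [leRHS]mulrC expr2 -[leRHS]mulrA ler_pM2l//.
Qed.

Let continuous_geodesic : continuous geodesic.
Proof.
move=> t; have ce : expR @ t --> expR t by exact: continuous_expR.
have cN : (fun s => expR (- s)) @ t --> expR (- t).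
  by apply: continuous_comp; [exact: opp_continuous | exact: continuous_expR].
apply: cvgZ; last by apply: cvgD; apply: cvgZ => //; exact: cvg_cst.
apply: cvgV; first by rewrite gt_eqF.
apply: cvgD; first exact: cvg_cst.
by apply: cvgD; apply: cvgM => //; exact: cvg_cst.
Qed.

Lemma hyperbolic_length_geodesic (L : R) : 0 <= L ->
  hyperbolic_length (geodesic 0) (geodesic L) L.
Proof.
move=> L0; exists 0, L, geodesic; split => //.
(* Since [Y r >= 1], [arc_bounds] with tag [r] bounds chords by [(t - r) * expR L]. *)
- apply: (@lipschitz_rectifiable _ _ _ _ _ (expR L)).
    exact: continuous_subspaceT.
  move=> r t r0 rt tL.
  have /andP[_] := arc_bounds r t r (introT andP (conj (lexx r) rt)).
  have : 1 * enorm (geodesic t - geodesic r) <= Y r * enorm (geodesic t - geodesic r).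
    by rewrite ler_wpM2r ?enorm_ge0// /Y lerDl.
  rewrite mul1r => H1 /(le_trans H1) H2; apply: le_trans H2 _.
  by rewrite mulrC ler_wpM2r ?subr_ge0// ler_expR; lra.
- by move=> t _; exact: unit_ball_geodesic.
rewrite -[X in is_line_integral _ _ _ _ X]subr0.
apply: is_line_integral_arclength => // eps e0.
(* A step [h < ln (1 + eps)] gives [expR h <= 1 + eps] and [expR (- h) >= 1 - h >= 1 - eps]. *)
exists (ln (1 + eps)); first by rewrite ln_gt0//; lra.
move=> r t tau _ _ hd rtaut; rewrite density_geodesic.
have := arc_bounds _ _ _ rtaut.
have h0 : 0 <= t - r by move: rtaut => /andP[]; lra.
have Eh : expR (t - r) <= 1 + eps.
  by rewrite -[leRHS]lnK ?posrE; [rewrite ler_expR ltW | lra].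
have Eh' : 1 - eps <= expR (- (t - r)).
  have := expR_ge1Dx (- (t - r)); have := @le_ln1Dx R eps; lra.
move=> /andP[H1 H2]; rewrite ler_norml; nra.
Qed.

End Geodesic.

(** The hypotheses give [g * D <= s * m], so [D + 2 * g * D <= m ^+ 2 + 2 * s * m]. *)
Lemma double_addr1_le {R : realType} (g s m D : R) :
  0 <= s -> 0 <= m -> 0 < D -> D <= m ^+ 2 -> g ^+ 2 <= s ^+ 2 / D ->
  1 + 2 * g <= (s + m) ^+ 2 / D.
Proof.
move=> s0 m0 D0 Dm; rewrite !ler_pdivlMr// => gs.
have gD : (g * D) ^+ 2 <= (s * m) ^+ 2.
  rewrite !exprMn (expr2 D) mulrA; apply: ler_pM => //; last exact: ltW.
  by rewrite mulr_ge0 ?sqr_ge0// ltW.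
have : g * D <= s * m.
  by rewrite (le_trans (ler_norm _))// -ler_sqr ?nnegrE ?mulr_ge0// real_normK ?num_real.
nra.
Qed.

(** * Geodesics between given points of the ball, and the lower bound of u *)

Section Connect.
Context {R : realType} {n : nat}.
Implicit Types (x y : 'rV[R]_n).

(** If [al * be <= 0], then [edot u v] would be negative and exceed [al * be] in absolute value,
    against Cauchy-Schwarz; so [al] and [be] have the same sign. *)
Lemma null_future (u v : 'rV[R]_n) (al be : R) :
  edot u u = al ^+ 2 -> edot v v = be ^+ 2 -> edot u v < al * be ->
  0 < al + be -> 0 < al /\ 0 < be.
Proof.
move=> uu vv uv ab.
have CS : edot u v ^+ 2 <= (al * be) ^+ 2 by rewrite exprMn -uu -vv edot_sqr_le.
have abp : 0 < al * be by rewrite ltNge; apply/negP => ab0; nra.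
by split; nra.
Qed.

(* [a] and [b] are the time coordinates, and [A] and [B] the space coordinates,
   of the endpoints on the hyperboloid; [M] is e^L for their distance [L]. *)
Lemma hyperbolic_length_hyperboloid (A B : 'rV[R]_n) (a b M : R) :
  0 < a -> 1 < M -> a ^+ 2 - edot A A = 1 -> b ^+ 2 - edot B B = 1 ->
  2 * M * (a * b - edot A B) = M ^+ 2 + 1 ->
  hyperbolic_length ((1 + a)^-1 *: A) ((1 + b)^-1 *: B) (ln M).
Proof.
move=> a0 M1 aA bB cM; have M0 : 0 < M by lra.
have D0 : 0 < M ^+ 2 - 1 by rewrite subr_gt0 exprn_egt1.
have Dn0 : M ^+ 2 - 1 != 0 by rewrite gt_eqF.
have Mn0 : M != 0 by rewrite gt_eqF.
(* These solve [u + v = A] and [M *: u + M^-1 *: v = B], and [al], [be] solve the same system for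
   [a], [b]: the geodesic meets the two points at times 0 and [ln M]. *)
pose u := (M ^+ 2 - 1)^-1 *: (M *: B - A).
pose v := (M / (M ^+ 2 - 1)) *: (M *: A - B).
pose al := (b * M - a) / (M ^+ 2 - 1).
pose be := M * (M * a - b) / (M ^+ 2 - 1).
have AA : edot A A = a ^+ 2 - 1 by lra.
have BB : edot B B = b ^+ 2 - 1 by lra.
have AB : edot A B = a * b - (M ^+ 2 + 1) / (2 * M).
  by rewrite -cM; field.
have uu : edot u u = al ^+ 2.
  by rewrite /u /al !edotE (edotC B A) AA BB AB; field; rewrite Mn0 Dn0.
have vv : edot v v = be ^+ 2.
  by rewrite /v /be !edotE (edotC B A) AA BB AB; field; rewrite Mn0 Dn0.
have uv : edot u v = al * be - 2^-1.
  by rewrite /u /v /al /be !edotE (edotC B A) AA BB AB; field; rewrite Mn0 Dn0.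
have ab : al + be = a by rewrite /al /be; field.
have [||al0 be0] := null_future _ _ _ _ uu vv; [by rewrite uv; lra | by rewrite ab|].
have L0 : 0 <= ln M by rewrite ln_ge0// ltW.
have := hyperbolic_length_geodesic _ _ _ _ (ltW al0) (ltW be0) uu vv uv _ L0.
rewrite /geodesic oppr0 expR0 expRN lnK ?posrE// !mulr1 !scale1r ab.
have -> : u + v = A.
  rewrite /u /v !scalerBr !scalerA.
  apply/rowP => i; rewrite !mxE; by field.
have -> : M *: u + M^-1 *: v = B.
  rewrite /u /v !scalerBr !scalerA.
  apply/rowP => i; rewrite !mxE; by field; rewrite Mn0 Dn0.
have -> // : al * M + be / M = b.
by rewrite /al /be; field; rewrite Mn0 Dn0.
Qed.

(** The hyperboloid construction requires [1 < M], so coincident points get a constant curve. *)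
Lemma hyperbolic_length_refl x : unit_ball x -> hyperbolic_length x x 0.
Proof.
move=> x1; exists 0, 0, (fun=> x); split => //.
  apply: (@lipschitz_rectifiable _ _ _ _ _ 0).
    by apply: continuous_subspaceT; exact: cst_continuous.
  by move=> r t _ _ _; rewrite subrr enorm0 mul0r.
move=> e e0; exists 1 => // s tau t /itv_partitionxx -> _ _.
by rewrite big_nil subrr normr0.
Qed.

Lemma exists_hyperbolic_length_le x y : (0 < n)%N -> unit_ball x -> unit_ball y ->
  exists2 I, hyperbolic_length x y I & I <= 2 * u_metric (@unit_ball R n) x y.
Proof.
move=> n0 x1 y1; rewrite u_metric_unit_ball//.
have x0 := enorm_ge0 x; have y0 := enorm_ge0 y.
have dx : 0 < 1 - enorm x by rewrite subr_gt0.
have dy : 0 < 1 - enorm y by rewrite subr_gt0.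
set s := enorm (x - y); have s0 : 0 <= s := enorm_ge0 _.
set m := Num.max _ _.
have m0 : 0 < m by rewrite lt_max dx.
pose X := 1 - enorm x ^+ 2; pose Y := 1 - enorm y ^+ 2.
have XE : X = (1 - enorm x) * (1 + enorm x) by rewrite /X; ring.
have YE : Y = (1 - enorm y) * (1 + enorm y) by rewrite /Y; ring.
have dd0 := mulr_gt0 dx dy.
have X0 : 0 < X by rewrite XE mulr_gt0//; lra.
have Y0 : 0 < Y by rewrite YE mulr_gt0//; lra.
have XY0 := mulr_gt0 X0 Y0.
pose sg := s / Num.sqrt (X * Y).
have sg0 : 0 <= sg by rewrite divr_ge0// sqrtr_ge0.
have sg2 : sg ^+ 2 = s ^+ 2 / (X * Y) by rewrite /sg expr_div_n (sqr_sqrtr (ltW XY0)).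
(* [E] is the positive root of [E ^+ 2 = 2 * sg * E + 1], so [L = 2 * ln E] satisfies
   [sinh (L / 2) = sg]. *)
pose E := sg + Num.sqrt (1 + sg ^+ 2).
have q0 : 0 <= Num.sqrt (1 + sg ^+ 2) := sqrtr_ge0 _.
have qE : Num.sqrt (1 + sg ^+ 2) ^+ 2 = 1 + sg ^+ 2.
  by rewrite sqr_sqrtr// addr_ge0// sqr_ge0.
have EE : E ^+ 2 = 2 * sg * E + 1 by rewrite /E; nra.
have E_ge1 : 1 <= E.
  by rewrite /E -[leLHS]add0r lerD// -{1}(sqrtr1 R) ler_wsqrtr// lerDl sqr_ge0.
have E_le : E <= (s + m) ^+ 2 / ((1 - enorm x) * (1 - enorm y)).
  have sgd : sg ^+ 2 <= s ^+ 2 / ((1 - enorm x) * (1 - enorm y)).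
    rewrite sg2 ler_wpM2l ?sqr_ge0// lef_pV2 ?posrE ?mulr_gt0//.
    apply: ler_pM; [exact: ltW | exact: ltW | rewrite XE | rewrite YE];
      by rewrite ler_peMr ?(ltW dx) ?(ltW dy)//; lra.
  have E_le2 : E <= 1 + 2 * sg by rewrite /E; nra.
  apply: le_trans E_le2 _; apply: double_addr1_le => //; first exact: ltW.
  rewrite expr2; apply: ler_pM; [exact: ltW | exact: ltW | |];
    by rewrite le_max lexx ?orbT.
have IE : 2 * ln E <= 2 * (2 * ln (s + m) - (ln (1 - enorm x) + ln (1 - enorm y))).
  rewrite ler_pM2l// -lnM// mulr_natl -lnXn; last lra.
  rewrite -ln_div ?posrE ?exprn_gt0 ?mulr_gt0//; last lra.
  by rewrite ler_ln ?posrE ?divr_gt0 ?exprn_gt0 ?mulr_gt0//; lra.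
have [xy|xy] := eqVneq x y.
  exists 0; first by rewrite -xy; exact: hyperbolic_length_refl.
  by apply: le_trans IE; rewrite mulr_ge0// ln_ge0.
have s_gt0 : 0 < s.
  rewrite lt_def s0 andbT; apply: contra_neq xy => s00.
  by apply/eqP; rewrite -subr_eq0; apply/eqP/enorm_eq0.
have sg_gt0 : 0 < sg by rewrite divr_gt0// sqrtr_gt0.
have E_gt1 : 1 < E by rewrite /E; nra.
exists (2 * ln E) => //.
have X'0 : 1 - edot x x != 0 by rewrite -sqr_enorm gt_eqF.
have Y'0 : 1 - edot y y != 0 by rewrite -sqr_enorm gt_eqF.
have two0 (c : R) : 1 - c + (1 + c) != 0 by rewrite gt_eqF//; lra.
(* The endpoints are lifted by the inverse of the projection from [(-1, 0)], and [E ^+ 2] is e^L. *)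
have := @hyperbolic_length_hyperboloid (2 / X *: x) (2 / Y *: y)
  ((1 + edot x x) / X) ((1 + edot y y) / Y) (E ^+ 2).
rewrite lnXn; last lra.
rewrite -(mulr_natl (ln E)) !scalerA !edotE /X /Y !sqr_enorm.
have -> : (1 + (1 + edot x x) / (1 - edot x x))^-1 * (2 / (1 - edot x x)) = 1.
  by field; rewrite X'0 two0.
have -> : (1 + (1 + edot y y) / (1 - edot y y))^-1 * (2 / (1 - edot y y)) = 1.
  by field; rewrite Y'0 two0.
rewrite !scale1r; apply.
- by apply: divr_gt0; [have := edot_ge0 x; lra | rewrite -sqr_enorm].
- by rewrite exprn_egt1.
- by field.
- by field.
(* The Lorentz product of the lifts is [cosh L = 1 + 2 sinh^2 (L / 2)]. *)
have -> : (1 + edot x x) / (1 - edot x x) * ((1 + edot y y) / (1 - edot y y)) -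
   2 / (1 - edot x x) * (2 / (1 - edot y y) * edot x y) = 1 + 2 * sg ^+ 2.
  rewrite sg2 /s /X /Y !sqr_enorm !edotE (edotC y x); field.
  by rewrite X'0 Y'0.
have -> : (E ^+ 2) ^+ 2 + 1 = 2 * E ^+ 2 + (E ^+ 2 - 1) ^+ 2 by ring.
have -> : E ^+ 2 - 1 = 2 * sg * E by rewrite EE; ring.
by ring.
Qed.

End Connect.

Theorem theorem3p2 (R : realType) (n : nat) (hn : (2 <= n)%N)
    (x y : 'rV[R]_n) (hx : unit_ball x) (hy : unit_ball y) :
  2^-1 * hyperbolic_metric x y <= u_metric (@unit_ball R n) x y /\
  u_metric (@unit_ball R n) x y <= 4 * hyperbolic_metric x y.
Proof.
have n0 : (0 < n)%N by exact: ltnW.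
have [I xyI Iu] := exists_hyperbolic_length_le _ _ n0 hx hy.
(* With the constant [f = 1] the logarithmic bound says that lengths are nonnegative; this bounds
   the infimum set below and lets 3 be relaxed to 4 at the end. *)
have lb J : hyperbolic_length x y J -> 0 <= J.
  move=> /hyperbolic_length_ge_ln H; apply: le_trans (H (fun=> 1) _ _) => //.
    by move=> p q; rewrite subrr enorm_ge0.
  by move=> z _; rewrite gerBl enorm_ge0.
have rho0 : 0 <= hyperbolic_metric x y.
  by apply: lb_le_inf; [exists I | move=> J /lb].
split.
  have : hyperbolic_metric x y <= I by apply: ge_inf => //; exists 0 => J /lb.
  lra.
have : u_metric (@unit_ball R n) x y / 3 <= hyperbolic_metric x y.
  apply: lb_le_inf; first by exists I.
  move=> J xyJ; rewrite ler_pdivrMr// mulrC.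
  exact: u_metric_le_hyperbolic_length.
lra.
Qed.
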